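(* Let $\mathcal{H}=(V(\mathcal{H}),E(\mathcal{H}))$ be an $m$-uniform hypergraph with $n$ vertices and let $j\in V(\mathcal{H})$. Then the subgraph centrality of $j$ in $\mathcal{H}$ is $$C(j)=\sum_{d=0}^{\infty}\frac{\mu_{d}(j)}{d!},$$ where $\mu_0(j)=(m-1)^{n-1}$ and, for every integer $d\geq 1$, $$\mu_{d}(j)=(m-1)^{n-1}\sum_{F\in\mathcal{F}_{d}^{(j)}(\mathcal{H})}\frac{t(F)}{\prod_{v\in V(\widetilde{E}(F))\setminus\{j\}}d^{+}(v)}.$$ Here $d^{+}(v)$ is the outdegree of the vertex $v$ in $D(F)$, $V(\widetilde{E}(F))$ is the vertex set of $D(F)$, and $t(F)$ is the number of arborescences of $D(F)$.
   Context: Write $[n]=\{1,\dots,n\}$. A hypergraph $\mathcal{H}=(V(\mathcal{H}),E(\mathcal{H}))$ (here with $V(\mathcal{H})=[n]$, and $E(\mathcal{H})$ a set of subsets of $V(\mathcal{H})$) is $m$-uniform if $|e|=m\geq 2$ for every $e\in E(\mathcal{H})$; a word $i_1i_2\cdots i_m$ is said to belong to $E(\mathcal{H})$ if $\{i_1,\dots,i_m\}\in E(\mathcal{H})$. Its adjacency tensor $\mathcal{A}_{\mathcal{H}}=(h_{\alpha})_{\alpha\in[n]^m}$ has $h_\alpha=\frac{1}{(m-1)!}$ if $\alpha\in E(\mathcal{H})$ and $h_\alpha=0$ otherwise. Definition of $\mu_d(j)$ and $C(j)$. Let $A=(a_{ij})$ be an $n\times n$ auxiliary matrix whose entries are independent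 variables, and for $i\in[n]$, $\alpha=i_2\cdots i_m\in[n]^{m-1}$ put $\frac{\partial}{\partial a_{i\alpha}}=\frac{\partial}{\partial a_{ii_2}}\cdots\frac{\partial}{\partial a_{ii_m}}$. For $j\in[n]$ and an integer $d\ge 0$, $$\mu_{d}(j)=(m-1)^{n-1}\sum_{d_1+\cdots+d_n=d}\ \prod_{i=1}^{n}\frac{1}{(d_i(m-1))!}\Big(\sum_{\alpha_i\in[n]^{m-1}}h_{i\alpha_i}\frac{\partial}{\partial a_{i\alpha_i}}\Big)^{d_i}\,(A^{d(m-1)})_{jj},$$ the sum being over nonnegative integers $d_1,\dots,d_n$. The subgraph centrality of the vertex $j$ is $C(j)=\sum_{d=0}^{\infty}\frac{\mu_d(j)}{d!}$ with this $\mu_d(j)$. Multi-digraphs. For $d\geq 1$ let $\mathcal{F}_d=\{(i_1\alpha_1,\dots,i_d\alpha_d)\mid 1\le i_1\le\cdots\le i_d\le n,\ \alpha_k\in[n]^{m-1},\ k=1,\dots,d\}$. For $F=(i_1\alpha_1,\dots,i_d\alpha_d)\in\mathcal{F}_d$ with $\alpha_k=j_1^{(k)}\cdots j_{m-1}^{(k)}$, let $\widetilde{E}(F)$ be the multiset of arcs consisting of $(i_k,j_1^{(k)}),\dots,(i_k,j_{m-1}^{(k)})$ for $k=1,\dots,d$ (multiplicities added), let $V(\widetilde{E}(F))$ be the set of endpoints of these arcs, and let $D(F)=(V(\widetilde{E}(F)),\widetilde{E}(F))$ be the corresponding multi-digraph. Outdegrees in $D(F)$ count arcs with multiplicity. Let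 $\omega(u,v)$ be the multiplicity of the arc $(u,v)$ in $D(F)$, and let $\widehat{D}(F)$ be the digraph obtained from $D(F)$ by removing duplicate arcs. An Eulerian closed walk of $D(F)$ is a closed walk that uses each arc $(u,v)$ of $\widehat{D}(F)$ exactly $\omega(u,v)$ times. $D(F)$ is Eulerian if it has Eulerian closed walks. A word $i_1\cdots i_s$ is in ascending order if $i_1\le\cdots\le i_s$. Let $\mathcal{F}_d(\mathcal{H})$ be the set of $(i_1\alpha_1,\dots,i_d\alpha_d)\in\mathcal{F}_d$ such that $i_k\alpha_k\in E(\mathcal{H})$ and $\alpha_k$ is in ascending order for all $k=1,\dots,d$, and let $\mathcal{F}_d^{(j)}(\mathcal{H})$ be the set of $F\in\mathcal{F}_d(\mathcal{H})$ such that $D(F)$ is Eulerian and contains the vertex $j$. For Eulerian $D(F)$, $t(F)$ denotes the number of spanning arborescences of $D(F)$ with a fixed root vertex, parallel arcs being regarded as distinct (as in the BEST theorem); for an Eulerian multi-digraph this number does not depend on the choice of the root. *)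

(* Defs.v *)
(* Uses MathComp, MathComp-Analysis and multinomials. *)
From HB Require Import structures.
From mathcomp Require Import all_boot all_order all_algebra.
From mathcomp Require Import boolp classical_sets reals topology normedtype.
From mathcomp Require Import sequences.
(* The notations of mpoly clash with those of MathComp-Analysis. *)
From mathcomp Require Import -(notations) mpoly.

Set Implicit Arguments.
Unset Strict Implicit.
Unset Printing Implicit Defensive.

Import Order.TTheory GRing.Theory Num.Theory.
Import numFieldNormedType.Exports.

Local Open Scope ring_scope.

(* The vertex set [n] is represented by 'I_n; a hypergraph on it is given by
   its set of edges. *)
Definition hypergraph (n : nat) := {set {set 'I_n}}.

Definition uniform (m n : nat) (H : hypergraph n) : bool :=
  (2 <= m)%N && [forall e in H, #|e| == m].

Definition word_in (n : nat) (H : hypergraph n) (w : seq 'I_n) : bool :=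
  [set x in w]%SET \in H.

(* The entries of the adjacency tensor; it is only used on words of length m. *)
Definition adj_tensor (R : realType) (m n : nat) (H : hypergraph n)
    (w : seq 'I_n) : R :=
  if word_in H w then ((m.-1)`!%:R)^-1 else 0.

(* Polynomials in the n * n independent entries of the auxiliary matrix A; the
   variable a_ij has index mxvec_index i j. *)
Definition aux_poly (R : realType) (n : nat) := mpoly (n * n) R.

Definition aux_mx (R : realType) (n : nat) : 'M[aux_poly R n]_n :=
  \matrix_(i, j) mpolyX R (mnm1 (mxvec_index i j)).

Definition d_entry (R : realType) (n : nat) (i k : 'I_n) :
    aux_poly R n -> aux_poly R n :=
  mderiv (mxvec_index i k).

(* d / d a_{i alpha} = d / d a_{i i_2} ... d / d a_{i i_m} *)
Definition d_word (R : realType) (n : nat) (i : 'I_n) (alpha : seq 'I_n) :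
    aux_poly R n -> aux_poly R n :=
  \big[comp/id]_(k <- alpha) d_entry i k.

Definition d_tensor (R : realType) (m n : nat) (H : hypergraph n) (i : 'I_n)
    (p : aux_poly R n) : aux_poly R n :=
  \sum_(alpha : (m.-1).-tuple 'I_n)
    adj_tensor R m H (i :: alpha) *: d_word i alpha p.

(* The composition index e is (d_1, ..., d_n), so d_i is the value e i.  In each
   summand of mu, d * (m - 1) derivations are applied to a homogeneous
   polynomial of degree d * (m - 1); the result is a constant polynomial, and
   mcoeff mnm0 reads off its value. *)
Definition mu (R : realType) (m n : nat) (H : hypergraph n) (d : nat)
    (j : 'I_n) : R :=
  (m.-1)%:R ^+ n.-1 *
  \sum_(e : {ffun 'I_n -> 'I_d.+1} | (\sum_(i < n) e i)%N == d)
    mcoeff mnm0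
      ((\big[comp/id]_(i < n)
          (fun p : aux_poly R n =>
             ((e i * m.-1)`!%:R)^-1 *: iter (e i) (d_tensor m H i) p))
        ((aux_mx R n ^+ (d * m.-1)) j j)).

Definition subgraph_centrality (R : realType) (m n : nat) (H : hypergraph n)
    (j : 'I_n) : R :=
  limn (series (fun d => mu R m H d j / d`!%:R)).

(* A multi-digraph is given by its multiset of arcs, represented by a sequence;
   its vertices are the endpoints of its arcs. *)
Section Multidigraph.
Variable V : finType.
Implicit Type D : seq (V * V).

Definition vertices D : {set V} :=
  [set v | has (fun a => (a.1 == v) || (a.2 == v)) D]%SET.

Definition outdeg D (v : V) : nat := count (fun a => a.1 == v) D.

Definition mult D (u v : V) : nat := count_mem (u, v) D.

(* The closed walk v_0 v_1 ... v_{l-1} v_0 is represented by the sequence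
   c = [:: v_0; ...; v_{l-1}]. *)
Definition walk_arcs (c : seq V) : seq (V * V) := zip c (rot 1 c).

Definition eulerian_closed_walk D (c : seq V) : Prop :=
  cycle (fun u v => (u, v) \in undup D) c /\
  forall u v, (u, v) \in undup D -> count_mem (u, v) (walk_arcs c) = mult D u v.

Definition eulerian D : Prop := exists c, eulerian_closed_walk D c.

(* Arcs are designated by their positions in D, so that parallel arcs are
   distinct. *)
Definition arc D (a : 'I_(size D)) : V * V := tnth (in_tuple D) a.

(* T is the arc set of a spanning arborescence of D directed towards r, as in
   the BEST theorem: r has no outgoing arc in T, every other vertex has exactly
   one, and r can be reached from every vertex along T. *)
Definition spanning_arborescence D (r : V) (T : {set 'I_(size D)}) : bool :=
  [&& [forall a in T, (arc a).1 != r],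
      [forall v in vertices D :\ r, #|[set a in T | (arc a).1 == v]%SET| == 1%N]
    & [forall v in vertices D,
         connect (fun x y => [exists a in T, arc a == (x, y)]) v r]].

Definition num_arborescences D (r : V) : nat :=
  #|[set T | spanning_arborescence r T]%SET : {set {set 'I_(size D)}}|.

End Multidigraph.

(* A word i alpha of length m >= 2 is the pair (i, alpha). *)
Definition pointed_word (m n : nat) := ('I_n * (m.-1).-tuple 'I_n)%type.

Definition ascending (n : nat) (w : seq 'I_n) : bool :=
  sorted (fun x y : 'I_n => (x <= y)%N) w.

Definition Fd (m n d : nat) : {set d.-tuple (pointed_word m n)} :=
  [set F : d.-tuple (pointed_word m n) | ascending [seq x.1 | x <- F]]%SET.

Definition FdH (m n : nat) (H : hypergraph n) (d : nat) :
    {set d.-tuple (pointed_word m n)} :=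
  [set F in Fd m n d | all (fun x : pointed_word m n =>
     word_in H (x.1 :: x.2) && ascending x.2) F]%SET.

Definition digraph_of (m n : nat) (F : seq (pointed_word m n)) :
    seq ('I_n * 'I_n) :=
  [seq (x.1, v) | x <- F, v <- tval x.2].

Definition FdjH (m n : nat) (H : hypergraph n) (d : nat) (j : 'I_n) :
    {set d.-tuple (pointed_word m n)} :=
  [set F in FdH m H d |
     `[< eulerian (digraph_of F) >] && (j \in vertices (digraph_of F))]%SET.

(* Main.v *)
(* Deriving (A^N)_jj along the N arcs of D(F), N = d(m-1), counts the Eulerian
   closed trails of D(F) starting at j, parallel arcs being distinct: by the
   Leibniz rule both quantities satisfy the recursion that removes the first
   arc.  The BEST formula
     #trails = t(F) * d^+(j)! * prod_(v != j) (d^+(v) - 1)!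
   is proved by the same recursion, and the factors 1 / (d_i (m-1))! of mu_d are
   the 1 / d^+(i)!.  The same count is at most prod_v d^+(v)!, so that mu_d grows
   at most geometrically in d and the series of C(j) converges. *)
Require Import Defs.
From HB Require Import structures.
From mathcomp Require Import all_boot all_order all_algebra.
From mathcomp Require Import boolp classical_sets reals topology normedtype.
From mathcomp Require Import sequences.
From mathcomp Require Import -(notations) mpoly.
From mathcomp Require Import fintype finset zify.

Set Implicit Arguments.
Unset Strict Implicit.
Unset Printing Implicit Defensive.

Import Order.TTheory GRing.Theory Num.Theory.
Import numFieldNormedType.Exports.

(** * Eulerian trails and arborescences of a finite family of arcs; the BEST formula *)

Section EulerianTrails.
Variables (V I : finType) (f : I -> V * V).
Implicit Types (S T : {set I}) (u v r : V) (a : I).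

Local Open Scope nat_scope.

Definition out_arcs S v : {set I} := [set a in S | (f a).1 == v]%SET.
Definition odeg S v : nat := #|out_arcs S v|.
Definition ideg S v : nat := #|[set a in S | (f a).2 == v]%SET|.

(** Counts the trails from [u] to [r] that use every arc of [S] exactly once, arcs being told apart
    by their index. [trails] starts with fuel [k] equal to [#|S|], so the base case is reached
    exactly when no arc is left. *)
Fixpoint trails_rec k S u r : nat :=
  if k is k'.+1 then \sum_(a in out_arcs S u) trails_rec k' (S :\ a)%SET (f a).2 r
  else (u == r).

Definition trails S u r := trails_rec #|S| S u r.

Lemma trails0 u r : trails set0 u r = (u == r).
Proof. by rewrite /trails cards0. Qed.

Lemma trails_set0Vn S u r : S != set0 ->
  trails S u r = \sum_(a in out_arcs S u) trails (S :\ a)%SET (f a).2 r.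
Proof.
case/set0Pn => b bS; rewrite /trails (cardsD1 b) bS /=.
apply: eq_bigr => a; rewrite inE => /andP[aS _]; congr trails_rec.
by have := cardsD1 a S; have := cardsD1 b S; rewrite aS bS; lia.
Qed.

Lemma odegD1 S a v : a \in S -> odeg (S :\ a) v = odeg S v - ((f a).1 == v).
Proof.
move=> aS; rewrite /odeg [in RHS](cardsD1 a) inE aS /= addKn.
by apply: eq_card => b; rewrite !inE andbA.
Qed.

Lemma odeg_gt0 S a : a \in S -> 0 < odeg S (f a).1.
Proof. by move=> aS; apply/card_gt0P; exists a; rewrite inE aS eqxx. Qed.

Lemma idegD1 S a v : a \in S -> ideg (S :\ a) v = ideg S v - ((f a).2 == v).
Proof.
move=> aS; rewrite /ideg [in RHS](cardsD1 a) inE aS /= addKn.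
by apply: eq_card => b; rewrite !inE andbA.
Qed.

Lemma ideg_gt0 S a : a \in S -> 0 < ideg S (f a).2.
Proof. by move=> aS; apply/card_gt0P; exists a; rewrite inE aS eqxx. Qed.

(** A trail is determined by the order in which it uses the arcs leaving each vertex. In the
    induction, the choice of the first arc accounts for the top factor of the factorial at [u]. *)
Lemma trails_le S u r : trails S u r <= \prod_v (odeg S v)`!.
Proof.
have [k] := ubnP #|S|; elim: k S u => // k IHk S u leSk.
have [->|S0] := eqVneq S set0.
  by rewrite trails0 (leq_trans (leq_b1 _)) // prodn_gt0 // => v; apply: fact_gt0.
rewrite trails_set0Vn //.
case: (posnP (odeg S u)) => [u0|u_gt0].
  by rewrite big_pred0 // => a; rewrite (cards0_eq u0) inE.
rewrite [leqRHS](bigD1 u) //= -[in leqRHS](prednK u_gt0) factS (prednK u_gt0).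
rewrite -mulnA {1}/odeg -sum_nat_const; apply: leq_sum => a.
rewrite inE => /andP[aS /eqP au].
apply: leq_trans (IHk _ _ _) _.
  by move: leSk; rewrite (cardsD1 a) aS add1n ltnS; apply: leq_trans.
rewrite (bigD1 u) //= odegD1 // au eqxx subn1 leq_mul2l; apply/orP; right.
apply: leq_prod => v vu; rewrite odegD1 // au eq_sym (negbTE vu) subn0 //.
Qed.

(** Turns a positive count into an actual walk, as the definition of an Eulerian closed walk
    demands. *)
Lemma trails_walk S u r : 0 < trails S u r ->
  exists p : seq V, last u p = r /\
    perm_eq (zip (belast u p) p) [seq f a | a in S].
Proof.
have [k] := ubnP #|S|; elim: k S u => // k IHk S u leSk.
have [->|S0] := eqVneq S set0.
  rewrite trails0 lt0b => /eqP ->; exists [::]; split => //=.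
  by rewrite /image_mem enum_set0.
rewrite trails_set0Vn // lt0n sum_nat_eq0 negb_forall => /existsP[a].
rewrite negb_imply -lt0n => /andP[].
rewrite inE => /andP[aS /eqP au] /IHk[|p [lp pp]].
  by move: leSk; rewrite (cardsD1 a) aS add1n ltnS; apply: leq_trans.
exists ((f a).2 :: p); split => //=.
rewrite -[in (u, _)]au -surjective_pairing.
apply: perm_trans (_ : perm_eq (f a :: [seq f b | b in (S :\ a)%SET]) _).
  by rewrite perm_cons.
rewrite -/(map f (a :: enum _)); apply: perm_map.
apply: uniq_perm; rewrite ?enum_uniq //= ?mem_enum ?inE ?eqxx ?enum_uniq //.
by move=> b; rewrite in_cons !mem_enum !inE; case: eqVneq => [->|].
Qed.

Definition step T : rel V := fun x y => [exists a in T, f a == (x, y)].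

(** Arborescences towards [r] that span only [r] and the vertices with an outgoing arc in [S]: as
    the recursion removes arcs, exhausted vertices drop out. *)
Definition trees S r : {set {set I}} :=
  [set T : {set I} | [&& T \subset S,
      [forall v, odeg T v == (v != r) && (0 < odeg S v)]
    & [forall v, (0 < odeg S v) ==> connect (step T) v r]]]%SET.

(** The degree condition satisfied by the arcs of a trail from [u] to [r], written with sums to
    avoid truncated subtraction. *)
Definition balanced S u r :=
  forall v, odeg S v + (v == r) = ideg S v + (v == u).

Lemma balancedD1 S u r a : a \in S -> (f a).1 = u ->
  balanced S u r -> balanced (S :\ a)%SET (f a).2 r.
Proof.
move=> aS au bS v; rewrite odegD1 // idegD1 // au.
have := bS v; have := odeg_gt0 aS; have := ideg_gt0 aS; rewrite au.
have [->|vu] := eqVneq u v; rewrite ?eqxx; have [->|va] := eqVneq (f a).2 v; rewrite ?eqxx; rewrite ?(eq_sym v); lia.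
Qed.

Lemma connect_step_sub S T x y : S \subset T ->
  connect (step S) x y -> connect (step T) x y.
Proof.
move=> /subsetP sST; apply: connect_sub => {x y} x y /exists_inP[a aS fa].
by apply/connect1/exists_inP; exists a; rewrite ?sST.
Qed.

Lemma connect_step_ideg S T x r : T \subset S ->
  connect (step T) x r -> x != r -> 0 < ideg S r.
Proof.
move=> /subsetP sTS /connectP[p]; elim/last_ind: p => [|p y _].
  by move=> _ -> /=; rewrite eqxx.
rewrite rcons_path last_rcons => /andP[_ /exists_inP[a aT /eqP fa]] -> _.
by have := ideg_gt0 (sTS _ aT); rewrite fa.
Qed.

(** No arborescence contains an arc leaving its root, and the other outdegrees do not see [a]. *)
Lemma trees_root S r a : (f a).1 = r -> trees (S :\ a)%SET r = trees S r.
Proof.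
move=> ar; have dE v : v != r -> odeg (S :\ a) v = odeg S v.
  move=> vr; apply: eq_card => b; rewrite !inE; case: eqVneq => [->|] //=.
  by rewrite ar eq_sym (negbTE vr) andbF.
apply/setP => T; rewrite !inE.
have -> : [forall v, odeg T v == (v != r) && (0 < odeg (S :\ a) v)] =
          [forall v, odeg T v == (v != r) && (0 < odeg S v)].
  by apply: eq_forallb => v; case: (eqVneq v r) => //= vr; rewrite dE.
have -> : [forall v, (0 < odeg (S :\ a) v) ==> connect (step T) v r] =
          [forall v, (0 < odeg S v) ==> connect (step T) v r].
  apply: eq_forallb => v; case: (eqVneq v r) => [->|vr]; last by rewrite dE.
  by rewrite connect0 !implybT.
rewrite subsetD1 -andbA; case: (T \subset S) => //=.
case: (boolP [forall v, _]) => [/forallP/(_ r)|_]; last by rewrite andbF.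
rewrite eqxx /= => /eqP/cards0_eq/setP/(_ a).
by rewrite !inE ar eqxx andbT => ->.
Qed.

(** Another arc still leaves [u] after the removal, so the vertices to be spanned stay the same. *)
Lemma trees_branch S u r a : u != r -> a \in out_arcs S u -> 1 < odeg S u ->
  trees (S :\ a)%SET r = [set T in trees S r | a \notin T]%SET.
Proof.
move=> ur; rewrite inE => /andP[aS /eqP au] u_gt1.
have dE v : (0 < odeg (S :\ a) v) = (0 < odeg S v).
  by rewrite odegD1 // au; case: eqVneq => [<-|_]; rewrite ?subn0 //; lia.
apply/setP => T; rewrite !inE subsetD1 -!andbA; congr (_ && _).
under eq_forallb => v do rewrite dE.
under [X in _ && (_ && X)]eq_forallb => v do rewrite dE.
by rewrite andbC -!andbA.
Qed.

(** Double counting of the pairs of an arborescence and an arc leaving [u] outside it: each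
    arborescence uses exactly one of these arcs. *)
Lemma sum_trees_branch S u r : u != r -> 1 < odeg S u ->
  \sum_(a in out_arcs S u) #|trees (S :\ a)%SET r| =
  #|trees S r| * (odeg S u).-1.
Proof.
move=> ur u_gt1.
under eq_bigr => a ua.
  rewrite (trees_branch ur ua u_gt1) -sum1_card.
  under eq_bigl => T do rewrite inE.
  rewrite big_mkcondr /=.
  over.
rewrite exchange_big -sum_nat_const /=; apply: eq_bigr => T.
rewrite inE => /and3P[/subsetP sTS /forallP/(_ u)/eqP dT _].
rewrite -big_mkcondr sum1_card.
have -> : (odeg S u).-1 = odeg S u - odeg T u by rewrite dT ur; lia.
rewrite /odeg -[in RHS](@setIidPr _ (out_arcs S u) (out_arcs T u) _).
  rewrite -cardsD; apply: eq_card => b; rewrite !inE.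
  by rewrite unfold_in /= !inE; case: (b \in S) (b \in T) ((f b).1 == u) => [] [] [].
by apply/subsetP => b; rewrite !inE => /andP[/sTS -> ->].
Qed.

(** Balance leaves [u] with indegree 0, so [u] is a leaf of every arborescence, hanging by [a];
    deleting [a] is then a bijection. *)
Lemma card_trees_leaf S u r a : u != r -> balanced S u r ->
  out_arcs S u = [set a]%SET -> #|trees (S :\ a)%SET r| = #|trees S r|.
Proof.
move=> ur bS Su; have : a \in out_arcs S u by rewrite Su inE.
rewrite inE => /andP[aS /eqP au].
have du : odeg S u = 1 by rewrite /odeg Su cards1.
have iu : ideg S u = 0 by have := bS u; rewrite eqxx (negbTE ur) du; lia.
have bS' := balancedD1 aS au bS.
have Tu T : T \in trees S r -> a \in T.
  rewrite inE => /and3P[/subsetP sTS /forallP/(_ u)/eqP dT _].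
  have : 0 < odeg T u by rewrite dT ur du.
  case/card_gt0P => b; rewrite inE => /andP[bT bu].
  have : b \in out_arcs S u by rewrite inE sTS.
  by rewrite Su inE => /eqP <-.
have -> : trees (S :\ a)%SET r = [set T :\ a | T in trees S r]%SET; last first.
  rewrite card_in_imset // => T1 T2 /Tu a1 /Tu a2 eT.
  by rewrite -(setD1K a1) -(setD1K a2) eT.
(* A path starting elsewhere never enters [u], hence never uses [a]. *)
have conn T v : a \in T -> T \subset S -> v != u ->
    connect (step T) v r -> connect (step (T :\ a)%SET) v r.
  move=> aT /subsetP sTS + /connectP[p] + ->.
  elim: p v => [|y p IHp] v vu //= /andP[/exists_inP[b bT /eqP fb] yp].
  have yu : y != u.
    apply: contraTneq (ideg_gt0 (sTS _ bT)) => yu.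
    by rewrite fb /= yu iu.
  apply: connect_trans (IHp _ yu yp); apply/connect1/exists_inP; exists b.
    by rewrite !inE bT andbT; apply: contraNneq vu => ba; rewrite -au -ba fb.
  by rewrite fb.
apply/setP => T; apply/idP/imsetP => [|[{}T TS ->]].
  rewrite inE subsetD1 => /and3P[/andP[sTS aT] /forallP dT /forallP cT].
  exists (a |: T)%SET; last by rewrite setU1K.
  have dT' v : odeg (a |: T) v = odeg T v + (u == v).
    have /odegD1-/(_ v) : a \in (a |: T)%SET by rewrite setU11.
    rewrite setU1K // au => ->; case: eqVneq => [<-|_]; last by lia.
    by have := odeg_gt0 (setU11 a T); rewrite au; lia.
  rewrite inE subUset sub1set aS sTS /=; apply/andP; split; apply/forallP => v.
    rewrite dT' (eqP (dT v)) odegD1 // au; have [<-|] := eqVneq u v.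
      by rewrite du subnn ur.
    by rewrite subn0 addn0.
  apply/implyP => v_gt0; have [->|vu] := eqVneq v u; last first.
    apply: (connect_step_sub (subsetU1 a T)); have /implyP := cT v; apply.
    by rewrite odegD1 // au eq_sym (negbTE vu) subn0.
  apply: (@connect_trans _ _ (f a).2).
    by apply/connect1/exists_inP; exists a; rewrite ?setU11 // -au -surjective_pairing.
  apply: (connect_step_sub (subsetU1 a T)).
  (* If the head of [a] is not [r], balance of the remaining arcs gives it an outgoing arc, so [T]
     leads from it to [r]. *)
  have [->|a2r] := eqVneq (f a).2 r; first exact: connect0.
  have /implyP := cT (f a).2; apply.
  by have := bS' (f a).2; rewrite (negbTE a2r) eqxx; lia.
have aT := Tu _ TS; move: TS; rewrite inE => /and3P[sTS /forallP dT /forallP cT].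
rewrite inE setSD //=; apply/andP; split; apply/forallP => v.
  rewrite !odegD1 // (eqP (dT v)) au; case: (eqVneq u v) => [<-|]; last by rewrite !subn0.
  by rewrite ur du.
rewrite odegD1 // au; apply/implyP; have [->|vu] := eqVneq v u.
  by rewrite du.
rewrite subn0 => v_gt0; apply: conn => //.
by have /implyP := cT v; apply.
Qed.

(* The induction removes the first arc of the trail, so the trail is not
   assumed to be closed. *)
Lemma BEST S u r : balanced S u r ->
  trails S u r =
  #|trees S r| * ((odeg S r)`! * \prod_(v | v != r) ((odeg S v).-1)`!).
Proof.
have [k] := ubnP #|S|; elim: k S u => // k IHk S u leSk bS.
have odeg_set0 v : odeg set0 v = 0 by apply: eq_card0 => a; rewrite !inE.
have [S0|S0] := eqVneq S set0.
  move: bS; rewrite S0 => bS; rewrite trails0.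
  have ur : u == r.
    have := bS u; rewrite odeg_set0 eqxx.
    by have -> : ideg set0 u = 0 by [apply: eq_card0 => a; rewrite !inE]; case: eqP.
  rewrite ur odeg_set0 big1 => [|v _]; last by rewrite odeg_set0.
  rewrite [trees _ _](_ : _ = [set set0]%SET) ?cards1 //; apply/setP => T.
  rewrite !inE subset0; case: eqVneq => //= ->; apply/andP; split; apply/forallP => v.
    by rewrite !odeg_set0 andbF.
  by rewrite odeg_set0.
have IH a : a \in out_arcs S u -> trails (S :\ a)%SET (f a).2 r =
   #|trees (S :\ a)%SET r| * ((odeg (S :\ a)%SET r)`! *
     \prod_(v | v != r) ((odeg (S :\ a)%SET v).-1)`!).
  rewrite inE => /andP[aS /eqP au]; apply: IHk (balancedD1 aS au bS).
  by move: leSk; rewrite (cardsD1 a) aS add1n ltnS; apply: leq_trans.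
rewrite trails_set0Vn //; have [ur|ur] := eqVneq u r.
  move: bS IH; rewrite ur => bS IH.
  (* If no arc leaves [r], balance says that none enters it; the tails of the remaining arcs cannot
     reach [r], and both sides vanish. *)
  have [r0|r_gt0] := posnP (odeg S r).
    rewrite big_pred0 => [|a]; last by rewrite (cards0_eq r0) inE.
    suff -> : trees S r = set0 by rewrite cards0.
    apply/eqP; rewrite -subset0; apply/subsetP => T; rewrite inE.
    case/and3P=> sTS _ /forallP cT; have [a aS] := set0Pn _ S0.
    have /implyP/(_ (odeg_gt0 aS)) := cT (f a).1.
    move=> /(connect_step_ideg sTS) ir; have := bS r; rewrite r0 eqxx.
    suff : 0 < ideg S r by lia.
    by apply: ir; apply: contraTneq (odeg_gt0 aS) => ->; rewrite r0.
  (* Every first arc leaves the arborescences unchanged; the [odeg S r] equal terms raise the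
     factorial at [r] by one step. *)
  under eq_bigr => a ra.
    rewrite (IH a ra); move: (ra); rewrite inE => /andP[aS /eqP ar].
    rewrite trees_root // (odegD1 _ aS) ar eqxx subn1.
    under eq_bigr => v vr do rewrite (odegD1 _ aS) ar eq_sym (negbTE vr) subn0.
    over.
  rewrite sum_nat_const -/(odeg S r) mulnCA; congr (_ * _).
  by rewrite mulnA; congr (_ * _); rewrite -[in RHS](prednK r_gt0) factS prednK.
have u_gt0 : 0 < odeg S u by have := bS u; rewrite eqxx (negbTE ur); lia.
(* A single outgoing arc makes [u] a leaf. With several, the double count supplies the factor
   [(odeg S u).-1] that completes the factorial at [u]. *)
have [u1|u_gt1] : odeg S u = 1 \/ 1 < odeg S u by lia.
  have /eqP/cards1P[a Su] := u1.
  rewrite Su big_set1 IH ?Su ?inE // (card_trees_leaf ur bS Su).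
  have : a \in out_arcs S u by rewrite Su inE.
  rewrite inE => /andP[aS /eqP au].
  rewrite odegD1 // au (negbTE ur) subn0; congr (_ * (_ * _)).
  apply: eq_bigr => v vr; rewrite odegD1 // au.
  by case: eqVneq => [<-|_]; rewrite ?subn0 // u1.
under eq_bigr => a ua.
  rewrite (IH a ua); move: (ua); rewrite inE => /andP[aS /eqP au].
  rewrite (odegD1 _ aS) au (negbTE ur) subn0 (bigD1 u) //=.
  rewrite (odegD1 _ aS) au eqxx subn1.
  under eq_bigr => v /andP[vr vu]
    do rewrite (odegD1 _ aS) au eq_sym (negbTE vu) subn0.
  over.
rewrite -big_distrl /= sum_trees_branch // -mulnA; congr (_ * _).
rewrite mulnCA; congr (_ * _); rewrite [in RHS](bigD1 u) //= mulnA; congr (_ * _).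
by case: (odeg S u) u_gt1 => [|[|d]].
Qed.

End EulerianTrails.

(** * Derivatives of the powers of the auxiliary matrix, and independence of the root *)

Section EntryDerivatives.
Variables (R : realType) (n : nat).
Local Open Scope ring_scope.

Lemma mnm_neq0 (N : nat) (m : multinom N) : m != mnm0 -> exists l, m l != 0%N.
Proof.
move=> m0; apply/existsP; apply: contraNT m0 => /existsPn h.
by apply/eqP/mnmP => l; rewrite mnm0E; apply/eqP; rewrite -[_ == _]negbK.
Qed.

(** Leibniz rule: at most one derivation can hit the variable, and it is one of the [m i]
    derivations along [i]. When [m i] is 0, the truncated [mnm_sub] is harmless because its
    coefficient vanishes. *)
Lemma mderivm_mulXl (N : nat) (i : 'I_N) (m : multinom N) (p : mpoly N R) :
  mderivm m (mpolyX R (mnm1 i) * p) =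
  mpolyX R (mnm1 i) * mderivm m p + (m i)%:R *: mderivm (mnm_sub m (mnm1 i)) p.
Proof.
have [k] := ubnP (mdeg m); elim: k m p => // k IHk m p.
have [->|m0] := eqVneq m mnm0.
  by rewrite !mderivm0m mnm0E scale0r addr0.
have [l ml] := mnm_neq0 m0.
have /submK {m0} : lem (mnm1 l) m by rewrite lep1mP.
move: (mnm_sub m _) => m' {ml} <-{m}; rewrite mdegD mdeg1 addn1 ltnS => mk.
rewrite addmC !mderivmDm mderivmU1m mderivM mderivX mnm1E mderivmD IHk //.
have -> : mnm_sub (mnm1 i) (mnm1 l) = if i == l then mnm0 else mnm1 i.
  apply/mnmP => q; rewrite mnmBE !mnm1E; case: (eqVneq i l) => [->|il].
    by rewrite subnn mnm0E.
  by rewrite mnm1E; case: (i =P q) => [<-|//]; rewrite eq_sym (negbTE il).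
rewrite mnmDE mnm1E [l == i]eq_sym -scalerAl mderivmZ mderivmU1m addrCA.
congr (_ + _); case: (eqVneq i l) => [->|il].
  rewrite mpolyX0 mul1r scale1r natrD scalerDl scale1r addmC addmK; congr (_ + _).
  have [->|ml] := eqVneq (m' l) 0%N; first by rewrite !scale0r.
  by rewrite -mderivmU1m -mderivmDm addmC submK // lep1mP.
rewrite scale0r add0r add0n; have [->|mi] := eqVneq (m' i) 0%N.
  by rewrite !scale0r.
by rewrite -mderivmU1m -mderivmDm addmBA // lep1mP.
Qed.

Definition entry_mnm (a : 'I_n * 'I_n) : multinom (n * n) :=
  mnm1 (mxvec_index a.1 a.2).

(** Injectivity is read off the unit matrices, which [mxvec] sends to unit row vectors. *)
Lemma eq_mxvec_index (i i' j j' : 'I_n) :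
  (mxvec_index i j == mxvec_index i' j') = ((i, j) == (i', j')).
Proof.
apply/eqP/eqP => [|[-> ->] //] /(congr1 (@delta_mx R 1 _ 0)).
rewrite -!mxvec_delta => /(can_inj mxvecK) /matrixP/(_ i j).
rewrite !mxE !eqxx /=; case: (eqVneq i i') => [->|_]; case: (eqVneq j j') => [->|_] //=;
  by move/eqP; rewrite oner_eq0.
Qed.

(** By cyclicity of the trace, the [k] Leibniz terms agree. The extra power [l] receives the factors
    that the induction rotates to the right. *)
Lemma mxtrace_mderiv_pow (N k l : nat) (i : 'I_N) (A : 'M[mpoly N R]_n) :
  \tr (map_mx (mderiv i) (A ^+ k) *m A ^+ l) =
  \tr (map_mx (mderiv i) A *m A ^+ (k + l).-1) *+ k.
Proof.
elim: k l => [|k IHk] l.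
  rewrite mulr0n expr0 [map_mx _ _](_ : _ = 0) ?mul0mx ?raddf0 //.
  by apply/matrixP => x y; rewrite !mxE -mpolyC_nat mderivC.
rewrite exprS [map_mx _ _](_ : _ =
    map_mx (mderiv i) A *m A ^+ k + A *m map_mx (mderiv i) (A ^+ k)); last first.
  apply/matrixP => x y; rewrite !mxE raddf_sum -big_split /=.
  by apply: eq_bigr => z _; rewrite !mxE mderivM.
rewrite mulmxDl raddfD /= -mulmxA -[A ^+ k *m A ^+ l]/(A ^+ k * A ^+ l) -exprD mulrSr addrC; congr (_ + _).
rewrite -mulmxA mxtrace_mulC -mulmxA -[_ *m A]/(_ * A) -exprSr IHk.
by rewrite addnS.
Qed.

Lemma mderiv_mxtrace_aux_mx (N : nat) (x y : 'I_n) :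
  mderiv (mxvec_index x y) (\tr (aux_mx R n ^+ N)) =
  (aux_mx R n ^+ N.-1) y x *+ N.
Proof.
have -> : mderiv (mxvec_index x y) (\tr (aux_mx R n ^+ N)) =
    \tr (map_mx (mderiv (mxvec_index x y)) (aux_mx R n ^+ N)).
  by rewrite raddf_sum; apply: eq_bigr => i _; rewrite mxE.
have := mxtrace_mderiv_pow N 0 (mxvec_index x y) (aux_mx R n).
rewrite expr0 mulmx1 addn0 => ->; congr (_ *+ _).
have -> : map_mx (mderiv (mxvec_index x y)) (aux_mx R n) = delta_mx x y.
  apply/matrixP => i j; rewrite !mxE mderivX mnm1E eq_mxvec_index // xpair_eqE.
  case: eqVneq => [->|_]; last by rewrite scale0r.
  case: eqVneq => [->|_]; last by rewrite scale0r.
  rewrite scale1r -mpolyX0; congr mpolyX; apply/mnmP => k.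
  by rewrite mnmBE subnn mnm0E.
rewrite /mxtrace (bigD1 x) //= big1 => [|i ix].
  rewrite addr0 mxE (bigD1 y) //= big1 => [|k ky].
    by rewrite mxE !eqxx mul1r addr0.
  by rewrite mxE eqxx (negbTE ky) mul0r.
by rewrite mxE big1 // => k _; rewrite mxE (negbTE ix) mul0r.
Qed.

Lemma mderivm_aux_mxS k m u r :
  mderivm m ((aux_mx R n ^+ k.+1) u r) =
  \sum_x (aux_mx R n u x * mderivm m ((aux_mx R n ^+ k) x r) +
    (m (mxvec_index u x))%:R *:
      mderivm (mnm_sub m (entry_mnm (u, x))) ((aux_mx R n ^+ k) x r)).
Proof.
rewrite exprS mxE raddf_sum /=; apply: eq_bigr => x _.
by rewrite mxE mderivm_mulXl.
Qed.

(** By degree. This kills the terms of the first-arc recursion in which the leading variable is not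
    differentiated. *)
Lemma mderivm_aux_mx_eq0 k m u r : (k < mdeg m)%N ->
  mderivm m ((aux_mx R n ^+ k) u r) = 0.
Proof.
elim: k m u r => [|k IHk] m u r mk.
  have /mnm_neq0[l] : m != mnm0 by rewrite -mdeg_eq0 -lt0n.
  rewrite -lep1mP => /submK <-; rewrite addmC mderivmDm mderivmU1m.
  by rewrite expr0 mxE -mpolyC_nat mderivC raddf0.
rewrite mderivm_aux_mxS big1 // => x _; rewrite IHk ?mulr0 ?add0r; last by lia.
have [->|mx] := eqVneq (m (mxvec_index u x)) 0%N; first by rewrite scale0r.
rewrite IHk ?scaler0 //.
move: mk; rewrite -{1}[m](@submK _ (entry_mnm (u, x))) ?lep1mP //.
by rewrite mdegD mdeg1 addn1.
Qed.

Section ArcMonomial.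
Variables (I : finType) (f : I -> 'I_n * 'I_n).
Implicit Types (S : {set I}).

Definition arcs_mnm S := \big[mnm_add/mnm0]_(a in S) entry_mnm (f a).

Lemma mdeg_arcs_mnm S : mdeg (arcs_mnm S) = #|S|.
Proof.
rewrite mdeg_sum -sum1_card; apply: eq_bigr => a _; exact: mdeg1.
Qed.

Lemma arcs_mnmE S u v :
  arcs_mnm S (mxvec_index u v) = #|[set a in S | f a == (u, v)]%SET|.
Proof.
rewrite mnm_sumE -sum1_card big_mkcond [RHS]big_mkcond.
apply: eq_bigr => a _; rewrite !inE mnm1E eq_mxvec_index -surjective_pairing.
by case: (a \in S) (f a == _) => [] [].
Qed.

Lemma arcs_mnmD1 S a : a \in S ->
  mnm_sub (arcs_mnm S) (entry_mnm (f a)) = arcs_mnm (S :\ a)%SET.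
Proof.
move=> aS; rewrite /arcs_mnm (bigD1 a) //= addmC addmK.
by apply: eq_bigl => b; rewrite !inE andbC.
Qed.

(* An entry of a power of the auxiliary matrix generates walks; the derivatives
   extract those whose arcs are the ones in S. *)
Lemma trails_mcoeff S u r :
  mcoeff mnm0 (mderivm (arcs_mnm S) ((aux_mx R n ^+ #|S|) u r)) =
  (trails f S u r)%:R.
Proof.
have [k] := ubnP #|S|; elim: k S u => // k IHk S u leSk.
have [->|S0] := eqVneq S set0.
  rewrite cards0 trails0 /arcs_mnm big_set0 mderivm0m expr0 mxE.
  by rewrite -mpolyC_nat mcoeffC eqxx mulr1.
have -> : #|S| = #|S|.-1.+1 by move: S0; rewrite -card_gt0; case: #|S|.
rewrite mderivm_aux_mxS trails_set0Vn // raddf_sum /= natr_sum.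
under eq_bigr => x _.
  rewrite mderivm_aux_mx_eq0; last first.
    by move: S0; rewrite mdeg_arcs_mnm -card_gt0; case: #|S|.
  rewrite mulr0 add0r arcs_mnmE mcoeffZ.
  rewrite -sum1_card natr_sum mulr_suml.
  over.
(* The exponent of a variable is split into its parallel arcs, turning the sum over the next vertex
   into one over the arcs leaving [u]. *)
rewrite (exchange_big_dep (mem (out_arcs f S u))) /=; last first.
  by move=> x a _; rewrite !inE => /andP[-> /eqP ->]; rewrite /= eqxx.
apply: eq_bigr => a; rewrite inE => /andP[aS /eqP au].
have eqS : #|S|.-1 = #|(S :\ a)%SET| by rewrite (cardsD1 a) aS.
rewrite (big_pred1 (f a).2) => [|x]; last first.
  by rewrite !inE aS -au [f a]surjective_pairing xpair_eqE eqxx eq_sym.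
rewrite mul1r -au -surjective_pairing arcs_mnmD1 // eqS IHk //.
by move: leSk; rewrite (cardsD1 a) aS add1n ltnS; apply: leq_trans.
Qed.

(** Multiplied by [#|S|], either side is the derivative along all arcs of [S] of the trace of the
    [#|S|]-th power, which singles out no arc. *)
Lemma trails_rotation S a b : a \in S -> b \in S ->
  trails f (S :\ a)%SET (f a).2 (f a).1 = trails f (S :\ b)%SET (f b).2 (f b).1.
Proof.
have h c : c \in S -> (trails f (S :\ c)%SET (f c).2 (f c).1)%:R *+ #|S| =
    mcoeff mnm0 (mderivm (arcs_mnm S) (\tr (aux_mx R n ^+ #|S|))).
  move=> cS; have -> : arcs_mnm S = mnm_add (entry_mnm (f c)) (arcs_mnm (S :\ c)%SET).
    rewrite /arcs_mnm (bigD1 c) //=; congr mnm_add.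
    by apply: eq_bigl => d; rewrite !inE andbC.
  rewrite mderivmDm mderivmU1m mderiv_mxtrace_aux_mx raddfMn raddfMn /=.
  by rewrite [X in _ ^+ X.-1](cardsD1 c) cS add1n /= trails_mcoeff.
move=> aS bS; have := h a aS; rewrite -(h b bS) => /eqP.
have S_gt0 : (0 < #|S|)%N by apply/card_gt0P; exists a.
rewrite eqr_pMn2r //.
by rewrite eqr_nat => /eqP.
Qed.

Lemma closed_trails_odeg S a r : a \in S ->
  trails f S r r = (odeg f S r * trails f (S :\ a)%SET (f a).2 (f a).1)%N.
Proof.
move=> aS; rewrite trails_set0Vn; last by apply/set0Pn; exists a.
rewrite -sum_nat_const; apply: eq_bigr => b; rewrite inE => /andP[bS /eqP br].
by rewrite -[in RHS](trails_rotation bS aS) br.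
Qed.

(* The number of closed trails starting with a given arc does not depend on the
   arc. *)
Lemma card_trees_root S r r' : (forall v, odeg f S v = ideg f S v) ->
  (0 < odeg f S r)%N -> (0 < odeg f S r')%N ->
  #|trees f S r| = #|trees f S r'|.
Proof.
move=> bS r_gt0 r'_gt0; case/card_gt0P: (r_gt0) => a; rewrite inE => /andP[aS _].
pose P := (\prod_v ((odeg f S v).-1)`!)%N.
(* [P] treats all vertices alike: cancelling [odeg f S x] between BEST and [closed_trails_odeg]
   leaves a right-hand side independent of [x]. *)
have h x : (0 < odeg f S x)%N ->
    (#|trees f S x| * P = trails f (S :\ a)%SET (f a).2 (f a).1)%N.
  move=> x_gt0; apply/eqP; rewrite -(eqn_pmul2l x_gt0) -closed_trails_odeg //.
  rewrite BEST => [|v]; last by rewrite bS.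
  rewrite /P (bigD1 x) //= mulnCA [in X in X == _](mulnA (odeg f S x)).
  by case: (odeg f S x) x_gt0 => // d _; rewrite factS.
have P_gt0 : (0 < P)%N by apply: prodn_gt0 => v; apply: fact_gt0.
by apply/eqP; rewrite -(eqn_pmul2r P_gt0) !h.
Qed.

End ArcMonomial.
End EntryDerivatives.

(** * Multi-digraphs given as sequences of arcs, indexed by position *)

Section DigraphTrails.
Variable V : finType.
Implicit Types (D : seq (V * V)) (c : seq V) (u v r : V).

Definition digraph_trails D r : nat := trails (@Defs.arc V D) [set: _]%SET r r.

Lemma card_arc D (P : pred (V * V)) :
  #|[set a : 'I_(size D) | P (Defs.arc a)]%SET| = count P D.
Proof.
rewrite -sum1_card -sum1_count [RHS]big_tnth.
by apply: eq_bigl => a; rewrite inE.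
Qed.

Lemma odeg_arc D v : odeg (@Defs.arc V D) [set: _]%SET v = outdeg D v.
Proof. by rewrite /outdeg -card_arc; apply: eq_card => a; rewrite !inE. Qed.

Lemma ideg_arc D v :
  ideg (@Defs.arc V D) [set: _]%SET v = count (fun a => a.2 == v) D.
Proof. by rewrite -card_arc; apply: eq_card => a; rewrite !inE. Qed.

Lemma map_arc_setT D : [seq Defs.arc a | a in [set: 'I_(size D)]%SET] = D.
Proof. by rewrite /image_mem enum_setT -enumT map_tnth_enum. Qed.

Lemma path_zip (e : rel V) x p :
  path e x p = all (fun a => e a.1 a.2) (zip (belast x p) p).
Proof. by elim: p x => //= y p IHp x; rewrite IHp. Qed.

(** The walk stays inside [D], so the multiplicities also agree, being zero, on arcs outside [D]. *)
Lemma eulerian_closed_walkE D c :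
  eulerian_closed_walk D c <-> perm_eq (walk_arcs c) D.
Proof.
have walkE : cycle (fun u v => (u, v) \in undup D) c = all (mem D) (walk_arcs c).
  case: c => // x p; rewrite [LHS]path_zip belast_rcons /walk_arcs rot1_cons.
  by apply: eq_all => -[u v] /=; rewrite mem_undup.
rewrite /eulerian_closed_walk walkE; split => [[/allP wD wE] | pD].
  apply/allP => -[u v] _; apply/eqP; have [uvD|uvD] := boolP ((u, v) \in D).
    by apply: wE; rewrite mem_undup.
  by rewrite !(count_memPn _) //; apply: contra uvD => /wD.
split; first by rewrite (perm_all _ pD); apply/allP.
by move=> u v _; apply/permP.
Qed.

(** The tails and the heads of a closed walk [c] are listed by [c] and by its rotation. *)
Lemma eulerian_balanced D v : eulerian D -> outdeg D v = count (fun a => a.2 == v) D.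
Proof.
case=> c /eulerian_closed_walkE /permP pD; rewrite /outdeg -!pD /walk_arcs.
have sz : size c = size (rot 1 c) by rewrite size_rot.
rewrite -(count_map fst (pred1 v)) -(count_map snd (pred1 v)).
rewrite -/unzip1 -/unzip2 unzip1_zip ?sz // unzip2_zip ?sz //.
by apply/esym/permP; rewrite perm_rot.
Qed.

(** Shows that only the tuples of [FdjH] contribute to [mu]. The empty digraph is set apart: it has
    the empty trail but no vertex. *)
Lemma digraph_trails_gt0 D r : D != [::] -> (0 < digraph_trails D r)%N ->
  eulerian D /\ r \in vertices D.
Proof.
move=> D0 /trails_walk[p [lp]]; rewrite map_arc_setT => pD.
case/lastP: p => [|p x] in lp pD *.
  by move: D0; rewrite -size_eq0 -(perm_size pD).
move: lp pD; rewrite last_rcons => -> {x}; rewrite belast_rcons => pD; split.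
  by exists (r :: p); apply/eulerian_closed_walkE; rewrite /walk_arcs rot1_cons.
rewrite inE -(perm_has _ pD).
by case: p {pD} => [|y p] /=; rewrite eqxx.
Qed.

Lemma mem_vertices D v : eulerian D -> (v \in vertices D) = (0 < outdeg D v)%N.
Proof.
move=> eD; rewrite inE has_predU !has_count -eulerian_balanced //.
by rewrite /outdeg orbb.
Qed.

Lemma num_arborescencesE D r : eulerian D ->
  num_arborescences D r = #|trees (@Defs.arc V D) [set: _]%SET r|.
Proof.
move=> eD; apply: eq_card => T; rewrite !inE subsetT /=.
rewrite /spanning_arborescence andbA; congr (_ && _); last first.
  by apply: eq_forallb => v; rewrite mem_vertices // odeg_arc.
apply/andP/forallP => [[/forall_inP Tr /forall_inP Tv] v|dT].
  have [->|vr] := eqVneq v r; rewrite ?eqxx /=.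
    by apply/eqP/eq_card0 => a; rewrite inE; apply/andP => -[/Tr/negP].
  rewrite odeg_arc; case: posnP => [v0|v_gt0].
    rewrite -leqn0 -v0 -odeg_arc; apply: subset_leq_card.
    by apply/subsetP => a; rewrite !inE => /andP[].
  by apply: Tv; rewrite !inE vr; rewrite -mem_vertices // inE in v_gt0.
split; [apply/forall_inP => a aT | apply/forall_inP => v].
  apply/eqP => ar; have := odeg_gt0 (@Defs.arc V D) aT.
  by rewrite (eqP (dT _)) ar eqxx.
rewrite in_setD1 mem_vertices // => /andP[vr v_gt0].
by rewrite -/(odeg _ _ _) (eqP (dT v)) vr odeg_arc v_gt0.
Qed.

Lemma digraph_trails_le D r : (digraph_trails D r <= \prod_v (outdeg D v)`!)%N.
Proof.
apply: leq_trans (trails_le _ _ _ _) _.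
by under eq_bigr => v _ do rewrite odeg_arc.
Qed.

(** BEST in product form: away from [r], each outdegree completes a factorial, and points of [V]
    outside the digraph have outdegree 0 and contribute 1. *)
Lemma digraph_trails_BEST D r : eulerian D -> r \in vertices D ->
  (digraph_trails D r * \prod_(v in (vertices D :\ r)%SET) outdeg D v =
   num_arborescences D r * \prod_v (outdeg D v)`!)%N.
Proof.
move=> eD rD; rewrite /digraph_trails BEST => [|v]; last first.
  by rewrite odeg_arc ideg_arc eulerian_balanced.
rewrite num_arborescencesE // -mulnA; congr (_ * _)%N.
rewrite odeg_arc -mulnA [in RHS](bigD1 r) //=; congr (_ * _)%N.
under eq_bigr => v _ do rewrite odeg_arc.
rewrite [X in (_ * X)%N]big_mkcond [X in (X * _)%N]big_mkcond [RHS]big_mkcond.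
rewrite -big_split; apply: eq_bigr => v _ /=; rewrite in_setD1 mem_vertices //.
by case: (v =P r) => //= _; case: (outdeg D v) => //= d; rewrite factS mulnC.
Qed.

End DigraphTrails.

Lemma num_arborescences_root (R : realType) (n : nat) (D : seq ('I_n * 'I_n)) r r' :
  eulerian D -> r \in vertices D -> r' \in vertices D ->
  num_arborescences D r = num_arborescences D r'.
Proof.
move=> eD; rewrite !mem_vertices // => rD r'D; rewrite !num_arborescencesE //.
apply: (card_trees_root R); rewrite ?odeg_arc // => v.
by rewrite odeg_arc ideg_arc eulerian_balanced.
Qed.

(** * Tuples, ascending words and compositions *)

Lemma card_perm_eq_tuple (T : finType) (k : nat) (t : k.-tuple T) :
  uniq t -> #|[set s : k.-tuple T | perm_eq s t]%SET| = k`!.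
Proof.
move=> ut; rewrite cardE -(size_map val) -[in RHS](size_tuple t).
rewrite -(size_permutations ut); apply/perm_size/uniq_perm.
- by rewrite map_inj_uniq ?enum_uniq //; apply: val_inj.
- exact: permutations_uniq.
move=> s; rewrite mem_permutations; apply/mapP/idP => [[s' + ->]|st].
  by rewrite mem_enum inE.
have ss : size s == k by rewrite (perm_size st) size_tuple.
by exists (Tuple ss); rewrite // mem_enum inE.
Qed.

Lemma big_tuple_cons (R : Type) (idx : R) (op : Monoid.com_law idx) (T : finType)
    (d : nat) (P : pred (d.+1.-tuple T)) (G : d.+1.-tuple T -> R) :
  \big[op/idx]_(F | P F) G F =
  \big[op/idx]_x \big[op/idx]_(F | P (cons_tuple x F)) G (cons_tuple x F).
Proof.
rewrite pair_big_dep (reindex (fun p => cons_tuple p.1 p.2)) //=.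
exists (fun F : d.+1.-tuple T => (thead F, [tuple of behead F])) => [[x F] _|F _] /=.
  by congr (_, _); apply: val_inj.
by rewrite [RHS]tuple_eta; apply: val_inj.
Qed.

Lemma sorted_flatten_nseq (n : nat) (e : 'I_n -> nat) (s : seq 'I_n) :
  pairwise (fun x y : 'I_n => (x < y)%N) s ->
  ascending (flatten [seq nseq (e i) i | i <- s]).
Proof.
rewrite /ascending sorted_pairwise; last by move=> x y z; apply: leq_trans.
elim: s => //= i s IHs /andP[/allP si /IHs]; rewrite pairwise_cat => ->.
rewrite andbT; apply/andP; split; last first.
  by elim: (e i) => //= k ->; rewrite andbT all_nseq leqnn orbT.
apply/allrelP => x y /nseqP[-> _] /flatten_mapP[k ks /nseqP[-> _]].
exact/ltnW/si.
Qed.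

Lemma count_flatten_nseq (n : nat) (e : 'I_n -> nat) (i : 'I_n) :
  count_mem i (flatten [seq nseq (e i) i | i <- enum 'I_n]) = e i.
Proof.
rewrite count_flatten -map_comp sumnE big_map big_enum /=.
rewrite (bigD1 i) //= count_nseq /= eqxx mul1n big1 ?addn0 // => k ki.
by rewrite count_nseq /= (negbTE ki).
Qed.

Lemma sum_count_mem (T : finType) (s : seq T) :
  (\sum_x count_mem x s)%N = size s.
Proof.
elim: s => [|y s IHs] /=; first by rewrite big1.
rewrite big_split /= IHs (bigD1 y) //= eqxx big1 // => x.
by rewrite eq_sym => /negbTE ->.
Qed.

(* The compositions (d_1, ..., d_n) of d correspond to the ascending words of
   length d. *)
Lemma ascending_count (n : nat) (e : 'I_n -> nat) (s : seq 'I_n) :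
  (s == flatten [seq nseq (e i) i | i <- enum 'I_n]) =
  ascending s && [forall i, count_mem i s == e i].
Proof.
have asc_w : ascending (flatten [seq nseq (e i) i | i <- enum 'I_n]).
  apply: sorted_flatten_nseq.
  have := iota_ltn_sorted 0 n; rewrite sorted_pairwise; last exact: ltn_trans.
  by rewrite -val_enum_ord pairwise_map.
apply/eqP/andP => [->|[asc_s /forallP es]].
  by split=> //; apply/forallP => i; rewrite count_flatten_nseq.
apply: sorted_eq asc_s asc_w _ => [y x z xy|x y /anti_leq/val_inj //|].
  exact: leq_trans xy.
by apply/allP => i _; rewrite /= count_flatten_nseq.
Qed.

(** * Expansion of [mu] as a sum of trail counts *)

Section MuExpansion.
Variables (R : realType) (m n : nat) (H : hypergraph n).
Hypothesis unifH : uniform m H.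
Local Open Scope ring_scope.
Implicit Types (p : aux_poly R n) (i : 'I_n) (w : seq 'I_n).

Definition word_mnm (x : pointed_word m n) : multinom (n * n) :=
  \big[mnm_add/mnm0]_(k <- tval x.2) entry_mnm (x.1, k).

Definition edge_word (x : pointed_word m n) : bool :=
  word_in H (x.1 :: x.2) && ascending x.2.

Lemma d_wordE i (alpha : seq 'I_n) p :
  d_word i alpha p =
  mderivm (\big[mnm_add/mnm0]_(k <- alpha) entry_mnm (i, k)) p.
Proof.
rewrite /d_word; elim: alpha => [|k alpha IH]; first by rewrite !big_nil mderivm0m.
by rewrite !big_cons /= IH addmC mderivmDm mderivmU1m.
Qed.

Lemma word_in_perm (w w' : seq 'I_n) : perm_eq w w' -> word_in H w = word_in H w'.
Proof.
move=> /perm_mem ww'; rewrite /word_in.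
by have -> : [set x in w]%SET = [set x in w']%SET by apply/setP => x; rewrite !inE ww'.
Qed.

(** A word of length [m] whose letters form a set of [m] elements repeats none. *)
Lemma edge_word_uniq i (alpha : (m.-1).-tuple 'I_n) :
  word_in H (i :: alpha) -> uniq alpha.
Proof.
case/andP: unifH => m_gt1 /forall_inP uH /uH /eqP cH.
suff /andP[] : uniq (i :: alpha) by [].
apply/card_uniqP; rewrite /= size_tuple (ltn_predK m_gt1) -[RHS]cH.
by apply: eq_card => x; rewrite !inE.
Qed.

(** Derivations commute, so sorting [alpha] does not change the term. The [(m.-1)!] orderings of its
    distinct letters cancel the tensor entry, leaving one term per ascending word. *)
Lemma d_tensorE i p :
  d_tensor m H i p =
  \sum_(x : pointed_word m n | (x.1 == i) && edge_word x) mderivm (word_mnm x) p.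
Proof.
rewrite [RHS](eq_bigl (fun x => (x.1 == i) && edge_word (i, x.2))); last first.
  by case=> i' a /=; case: eqVneq => // ->.
rewrite -(pair_big_dep (fun i' => i' == i) (fun _ a => edge_word (i, a))
  (fun i' a => mderivm (word_mnm (i', a)) p)) /= big_pred1_eq.
pose le := fun x y : 'I_n => (x <= y)%N.
have le_total : total le by move=> x y; apply: leq_total.
have le_trans : transitive le by move=> x y z; apply: leq_trans.
have le_anti : antisymmetric le by move=> x y /anti_leq/val_inj.
rewrite /d_tensor (eq_bigr (fun a : (m.-1).-tuple 'I_n =>
    if word_in H (i :: a) then
      ((m.-1)`!%:R)^-1 *: mderivm (word_mnm (i, a)) p else 0)); last first.
  move=> a _; rewrite /adj_tensor d_wordE; case: ifP => _ //.
  by rewrite scale0r.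
rewrite -big_mkcond (partition_big (fun a : (m.-1).-tuple 'I_n => [tuple of sort le a])
  (fun a => edge_word (i, a))) /=; last first.
  move=> a aH; rewrite /edge_word /ascending /= sort_sorted // andbT.
  by rewrite -(@word_in_perm (i :: a)) // perm_cons perm_sym perm_sort.
apply: eq_bigr => b /andP[/= bH bs].
have bE (a : (m.-1).-tuple 'I_n) : ([tuple of sort le a] == b) = perm_eq a b.
  apply/eqP/idP => [<-|ab]; first by rewrite perm_sym perm_sort.
  apply: val_inj; apply: (sorted_eq le_trans le_anti) => //=.
    exact: sort_sorted.
  by rewrite perm_sort.
rewrite (eq_big (fun a => a \in [set a : (m.-1).-tuple 'I_n | perm_eq a b]%SET)
  (fun _ => ((m.-1)`!%:R)^-1 *: mderivm (word_mnm (i, b)) p)); first last.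
- move=> a /andP[_]; rewrite bE => ab; congr (_ *: mderivm _ _).
  exact: perm_big.
- move=> a; rewrite inE bE andb_idl // => ab.
  by rewrite (@word_in_perm _ (i :: b)) // perm_cons.
rewrite sumr_const card_perm_eq_tuple ?(edge_word_uniq bH) //.
rewrite -scaler_nat scalerA mulfV ?scale1r // pnatr_eq0.
by rewrite -lt0n fact_gt0.
Qed.

Lemma d_tensor_sum (I : Type) (s : seq I) (P : pred I) (G : I -> aux_poly R n) i :
  d_tensor m H i (\sum_(x <- s | P x) G x) =
  \sum_(x <- s | P x) d_tensor m H i (G x).
Proof.
rewrite d_tensorE; under eq_bigr => x _ do rewrite raddf_sum.
by rewrite exchange_big; apply: eq_bigr => x _; rewrite d_tensorE.
Qed.

Lemma d_tensorZ c i p : d_tensor m H i (c *: p) = c *: d_tensor m H i p.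
Proof.
by rewrite !d_tensorE scaler_sumr; apply: eq_bigr => x _; rewrite mderivmZ.
Qed.

Lemma foldr_d_tensor w (d : nat) p : size w = d ->
  foldr (d_tensor m H) p w =
  \sum_(F : d.-tuple (pointed_word m n) | (map fst F == w) && all edge_word F)
     mderivm (\big[mnm_add/mnm0]_(x <- F) word_mnm x) p.
Proof.
elim: w d => [|i w IHw] [|d] // => [_|[/IHw IH]].
  rewrite (big_pred1 [tuple]) => [|F]; last by rewrite !tuple0.
  by rewrite big_nil mderivm0m.
rewrite big_tuple_cons /= IH d_tensor_sum.
rewrite [LHS](eq_bigr _ (fun F _ => d_tensorE _ _)).
rewrite exchange_big [LHS]big_mkcond; apply: eq_bigr => x _.
case: ifP => [/andP[/eqP xi xe]|xF].
  apply: eq_big => F; first by rewrite /= eqseq_cons xi eqxx xe.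
  by move=> _; rewrite /= big_cons addmC mderivmDm.
rewrite big_pred0 // => F; rewrite /= eqseq_cons.
by move: xF; case: (_ == i) => //= ->; rewrite andbF.
Qed.

Lemma big_comp_iter_d_tensor (c : 'I_n -> R) (e : 'I_n -> nat) (s : seq 'I_n) p :
  (\big[comp/id]_(i <- s) (fun p => c i *: iter (e i) (d_tensor m H i) p)) p =
  (\prod_(i <- s) c i) *:
    foldr (d_tensor m H) p (flatten [seq nseq (e i) i | i <- s]).
Proof.
elim: s => [|i s IHs]; first by rewrite !big_nil scale1r.
rewrite !big_cons /= IHs foldr_cat -scalerA; congr (_ *: _).
by elim: (e i) => //= k ->; rewrite d_tensorZ.
Qed.

Lemma outdeg_digraph_of (F : seq (pointed_word m n)) v :
  outdeg (digraph_of F) v = (count_mem v (map fst F) * m.-1)%N.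
Proof.
rewrite /outdeg /digraph_of; elim: F => //= x F IH.
rewrite count_cat IH mulnDl; congr (_ + _)%N.
rewrite count_map (eq_count (a2 := fun=> x.1 == v)) //.
by case: (x.1 == v); rewrite ?count_predT ?count_pred0 ?size_tuple ?mul1n.
Qed.

Lemma size_digraph_of (d : nat) (F : d.-tuple (pointed_word m n)) :
  size (digraph_of F) = (d * m.-1)%N.
Proof.
rewrite size_allpairs_dep -[in RHS](size_tuple F).
elim: (tval F) => //= x s ->; by rewrite size_tuple mulSn.
Qed.

Lemma digraph_trails_mcoeff (d : nat) (F : d.-tuple (pointed_word m n)) j :
  mcoeff mnm0 (mderivm (\big[mnm_add/mnm0]_(x <- F) word_mnm x)
    ((aux_mx R n ^+ (d * m.-1)) j j)) = (digraph_trails (digraph_of F) j)%:R.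
Proof.
rewrite /digraph_trails -trails_mcoeff cardsT card_ord -(size_digraph_of F).
congr (mcoeff _ (mderivm _ _)); rewrite /arcs_mnm.
transitivity (\big[mnm_add/mnm0]_(a <- digraph_of F) entry_mnm a).
  by rewrite big_allpairs_dep.
by rewrite big_tnth; apply: eq_bigl => a; rewrite inE.
Qed.

Lemma mu_trails (d : nat) (j : 'I_n) :
  mu R m H d j = (m.-1)%:R ^+ n.-1 * \sum_(F in FdH m H d)
    (digraph_trails (digraph_of F) j)%:R /
    (\prod_v (outdeg (digraph_of F) v)`!)%:R.
Proof.
rewrite /mu; congr (_ * _).
(* [cnt F] is the composition of [d] recorded by the first letters of [F]; the sum over [FdH] is
   grouped by it. *)
pose cnt (F : d.-tuple (pointed_word m n)) : {ffun 'I_n -> 'I_d.+1} :=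
  [ffun i => inord (count_mem i (map fst F))].
have cntE F i : cnt F i = count_mem i (map fst F) :> nat.
  by rewrite ffunE inordK // ltnS (leq_trans (count_size _ _)) // size_map size_tuple.
rewrite [RHS](partition_big cnt (fun e => (\sum_(i < n) e i)%N == d)) /=; last first.
  move=> F _; under eq_bigr => i _ do rewrite cntE.
  by rewrite sum_count_mem size_map size_tuple.
apply: eq_bigr => e /eqP ed.
have ->: index_enum 'I_n = enum 'I_n by rewrite enumT.
rewrite (big_comp_iter_d_tensor (fun i => ((e i * m.-1)`!%:R)^-1) (fun i => e i)).
set w := flatten _.
have sw : size w = d.
  rewrite -sum_count_mem -ed; apply: eq_bigr => i _; exact: count_flatten_nseq.
rewrite (foldr_d_tensor _ sw) linearZ /= raddf_sum mulr_sumr.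
(* Since first letters ascend, [F] lies over [e] exactly when they spell [w]. *)
apply: eq_big => [F|F /andP[/eqP Fw _]].
  rewrite ascending_count (_ : [forall i, _] = (cnt F == e)).
    by rewrite !inE andbAC.
  apply/forallP/eqP => [Fe|<- i]; last by rewrite cntE.
  by apply/ffunP => i; apply: val_inj; rewrite /= cntE; apply/eqP.
rewrite [X in _ * X](digraph_trails_mcoeff F j) mulrC; congr (_ * _).
rewrite natr_prod -prodfV; apply: eq_bigr => i _.
by rewrite outdeg_digraph_of Fw count_flatten_nseq.
Qed.

End MuExpansion.

Local Open Scope ring_scope.

(** The arborescences are first moved from [root] to [j], where the BEST formula applies. *)
Lemma digraph_trails_fact (R : realType) (n : nat) (D : seq ('I_n * 'I_n)) (j root : 'I_n) :
  eulerian D -> j \in vertices D -> root \in vertices D ->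
  (digraph_trails D j)%:R / (\prod_v (outdeg D v)`!)%:R =
  (num_arborescences D root)%:R / (\prod_(v in (vertices D :\ j)%SET) outdeg D v)%:R :> R.
Proof.
move=> eD jD rD; rewrite (num_arborescences_root R eD rD jD).
apply/eqP; rewrite eqr_div ?pnatr_eq0 -?lt0n; first last.
- rewrite prodn_cond_gt0 // => v; rewrite in_setD1 mem_vertices //.
  by case/andP.
- by apply: prodn_gt0 => v; apply: fact_gt0.
by rewrite -!natrM eqr_nat digraph_trails_BEST.
Qed.

(** * Geometric growth of [mu] and convergence of the series *)

Section Convergence.
Variables (R : realType) (m n : nat) (H : hypergraph n).
Hypothesis unifH : uniform m H.
Local Open Scope ring_scope.

Lemma mu_ge0 d j : 0 <= mu R m H d j.
Proof.
rewrite mu_trails // mulr_ge0 ?exprn_ge0 // sumr_ge0 // => F _.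
by rewrite divr_ge0.
Qed.

(** Each trail count is at most its denominator, so every summand is at most 1 and counting tuples
    suffices. *)
Lemma mu_le d j :
  mu R m H d j <= (m.-1)%:R ^+ n.-1 * #|{: pointed_word m n}|%:R ^+ d.
Proof.
rewrite mu_trails // ler_wpM2l ?exprn_ge0 // -natrX -card_tuple.
apply: (@le_trans _ _ (\sum_(F in FdH m H d) 1)).
  apply: ler_sum => F _; rewrite ler_pdivrMr ?mul1r ?ler_nat ?digraph_trails_le //.
  by rewrite ltr0n prodn_gt0 // => v; apply: fact_gt0.
by rewrite sumr_const ler_nat max_card.
Qed.

Lemma is_cvg_subgraph_centrality j :
  cvgn (series (fun d => mu R m H d j / d`!%:R)).
Proof.
pose K : R := #|{: pointed_word m n}|%:R.
(* The majorant is a multiple of the exponential series at [K]. *)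
refine (@series_le_cvg R _ (fun d => (m.-1)%:R ^+ n.-1 * exp_coeff K d) _ _ _ _).
- by move=> d; rewrite divr_ge0 ?mu_ge0.
- by move=> d; rewrite mulr_ge0 ?exprn_ge0 ?exp_coeff_ge0.
- move=> d; rewrite /exp_coeff /= [leRHS]mulrA.
  by rewrite ler_wpM2r ?invr_ge0 // mu_le.
exact/is_cvg_seriesZ/is_cvg_series_exp_coeff.
Qed.

End Convergence.

(** * The subgraph centrality formula *)

Local Open Scope classical_set_scope.
Local Open Scope ring_scope.

Theorem theorem4p3 (R : realType) (m n : nat) (H : hypergraph n)
    (unifH : uniform m H) (j : 'I_n) :
  [/\ series (fun d : nat => mu R m H d j / d`!%:R) @ \oo
        --> subgraph_centrality R m H j,
      mu R m H 0 j = (m.-1)%:R ^+ n.-1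
    & forall (d : nat) (root : d.-tuple (pointed_word m n) -> 'I_n),
        (1 <= d)%N ->
        (forall F, F \in FdjH m H d j -> root F \in vertices (digraph_of F)) ->
        mu R m H d j =
        (m.-1)%:R ^+ n.-1 *
        \sum_(F in FdjH m H d j)
          (num_arborescences (digraph_of F) (root F))%:R /
          (\prod_(v in (vertices (digraph_of F) :\ j)%SET)
             outdeg (digraph_of F) v)%:R].
Proof.
split; first exact: is_cvg_subgraph_centrality.
  (* For [d] = 0 only the empty tuple remains; its single empty trail contributes 1. *)
  rewrite mu_trails // [X in _ * X](big_pred1 [tuple]) => [|F]; last first.
    by rewrite !tuple0 !inE.
  rewrite /digraph_of /= /digraph_trails /trails cardsT card_ord /=.
  by rewrite eqxx big1 // divr1 mulr1.
move=> d root d_gt0 rootP; rewrite mu_trails //; congr (_ * _).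
rewrite [RHS](eq_bigl (fun F => (F \in FdH m H d) &&
  (`[< eulerian (digraph_of F) >] && (j \in vertices (digraph_of F))))); last first.
  by move=> F; rewrite [LHS]inE.
rewrite [RHS]big_mkcondr; apply: eq_bigr => F FH.
case: ifP => [/andP[/asboolP eF jF]|/negP nF].
  apply: digraph_trails_fact => //; apply: rootP.
  by rewrite [X in is_true X]inE FH jF andbT; apply/asboolP.
(* Outside [FdjH] the trail count must vanish; the digraph has [d * m.-1] arcs, a positive
   number. *)
have D0 : digraph_of F != [::].
  case/andP: unifH => m_gt1 _; rewrite -size_eq0 size_digraph_of.
  by rewrite muln_eq0; lia.
case: (posnP (digraph_trails (digraph_of F) j)) => [->|/(digraph_trails_gt0 D0)[eF jF]].
  by rewrite mul0r.
by case: nF; rewrite jF andbT; apply/asboolP.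
Qed.
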